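(* Vertex Cover Reconfiguration is at least as hard as Vertex Cover Compression: there is a polynomial-time many-one reduction from Vertex Cover Compression to Vertex Cover Reconfiguration.
   Context: All graphs are finite, simple and undirected. A vertex cover of a graph $G$ is a set $C\subseteq V(G)$ such that every edge of $G$ has at least one endpoint in $C$. Vertex Cover Compression: given a graph $G$ and a vertex cover $C$ of $G$ with $|C|=k\ge 1$, decide whether $G$ has a vertex cover of size $k-1$. Vertex Cover Reconfiguration: given a tuple $(G,S,T,k,\ell)$ where $G$ is a graph, $k,\ell$ are positive integers, and $S,T$ are vertex covers of $G$ with $|S|,|T|\le k$, decide whether $S$ can be transformed into $T$ by a sequence of at most $\ell$ steps, each adding a single vertex to or removing a single vertex from the current set, such that after every step the current set is a vertex cover of $G$ of size at most $k$. *)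

(* Defs.v *)
From HB Require Import structures.
From mathcomp Require Import all_boot all_order all_algebra.

Set Implicit Arguments.
Unset Strict Implicit.
Unset Printing Implicit Defensive.

(** * Graphs, vertex covers and reconfiguration *)

Record graph := Graph {
  order_of : nat;
  adj : rel 'I_order_of;
  adj_sym : symmetric adj;
  adj_irrefl : irreflexive adj }.

Definition vertices (G : graph) := 'I_(order_of G).

Definition is_cover (G : graph) (C : {set vertices G}) : bool :=
  [forall u, forall v, adj u v ==> ((u \in C) || (v \in C))].

Definition add_or_remove (T : finType) (A B : {set T}) : bool :=
  [exists v, ((v \notin A) && (B == v |: A)) || ((v \in A) && (B == A :\ v))].

Definition reconf_step (G : graph) (k : nat) (A B : {set vertices G}) : bool :=
  [&& add_or_remove A B, is_cover B & #|B| <= k].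

(* [s] lists the successive sets after the starting set [S], so [size s] is
   the number of steps. *)
Definition reconfigurable (G : graph) (k l : nat) (S T : {set vertices G}) :=
  exists s : seq {set vertices G},
    [/\ size s <= l, path (reconf_step k) S s & last S s = T].

(** * Encodings over a three-letter alphabet *)

(* [Some b] is the bit [b], [None] is the separator #. *)
Definition symbol : finType := option bool.

(* Characteristic vector, closed by #. *)
Definition enc_set (n : nat) (A : pred 'I_n) : seq symbol :=
  rcons [seq Some (A v) | v <- enum 'I_n] None.

(* The rows of the adjacency matrix, each closed by #, and a final #. *)
Definition enc_graph (G : graph) : seq symbol :=
  rcons (flatten [seq enc_set (adj u) | u <- enum 'I_(order_of G)]) None.

(* Binary notation, least significant bit first, closed by #. *)
Definition enc_nat (m : nat) : seq symbol :=
  rcons (mkseq (fun i => Some (odd (m %/ 2 ^ i))) (trunc_log 2 m).+1) None.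

(** * Decision problems *)

Record problem := Problem {
  instance : Type;
  encode : instance -> seq symbol;
  yes : instance -> Prop }.

(* The parameter k of a compression instance is [#|vcc_cover|]. *)
Record vcc_instance := VCCInstance {
  vcc_graph : graph;
  vcc_cover : {set vertices vcc_graph};
  vcc_coverP : is_cover vcc_cover;
  vcc_pos : 1 <= #|vcc_cover| }.

Definition vcc_encode (I : vcc_instance) : seq symbol :=
  enc_graph (vcc_graph I) ++ enc_set (fun v => v \in vcc_cover I).

Definition vcc_yes (I : vcc_instance) : Prop :=
  exists C : {set vertices (vcc_graph I)},
    is_cover C /\ #|C| = #|vcc_cover I| - 1.

Definition VertexCoverCompression : problem := Problem vcc_encode vcc_yes.

Record vcr_instance := VCRInstance {
  vcr_graph : graph;
  vcr_source : {set vertices vcr_graph};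
  vcr_target : {set vertices vcr_graph};
  vcr_k : nat;
  vcr_l : nat;
  vcr_k_pos : 0 < vcr_k;
  vcr_l_pos : 0 < vcr_l;
  vcr_sourceP : is_cover vcr_source;
  vcr_targetP : is_cover vcr_target;
  vcr_source_size : #|vcr_source| <= vcr_k;
  vcr_target_size : #|vcr_target| <= vcr_k }.

Definition vcr_encode (I : vcr_instance) : seq symbol :=
  enc_graph (vcr_graph I) ++
  enc_set (fun v => v \in vcr_source I) ++
  enc_set (fun v => v \in vcr_target I) ++
  enc_nat (vcr_k I) ++ enc_nat (vcr_l I).

Definition vcr_yes (I : vcr_instance) : Prop :=
  reconfigurable (vcr_k I) (vcr_l I) (vcr_source I) (vcr_target I).

Definition VertexCoverReconfiguration : problem :=
  Problem vcr_encode vcr_yes.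

(** * Deterministic multi-tape Turing machines *)

Inductive move := MoveLeft | Stay | MoveRight.

(* A two-way infinite tape over [G], where [None] is the blank: the cells to
   the left of the head (nearest first), the scanned cell, and the cells to its
   right (nearest first); all cells beyond the two lists are blank. *)
Record tape (G : Type) := Tape {
  tape_left : seq (option G);
  tape_head : option G;
  tape_right : seq (option G) }.

Definition write_move (G : Type) (t : tape G) (a : option G * move) : tape G :=
  let: Tape ls _ rs := t in
  match a.2 with
  | MoveLeft => Tape (behead ls) (head None ls) (a.1 :: rs)
  | Stay => Tape ls a.1 rs
  | MoveRight => Tape (a.1 :: ls) (head None rs) (behead rs)
  end.

Definition blank_tape (G : Type) : tape G := Tape [::] None [::].

Definition word_tape (G : Type) (w : seq G) : tape G :=
  let s := map Some w in Tape [::] (head None s) (behead s).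

(* The non-blank part of the tape is exactly [w], and the head is on its first
   letter. *)
Definition tape_holds (G : Type) (t : tape G) (w : seq G) : Prop :=
  exists i j, tape_left t = nseq i None /\
              tape_head t :: tape_right t = map Some w ++ nseq j None.

Record machine := Machine {
  tm_state : finType;
  tm_sym : finType;
  tm_letter : symbol -> tm_sym;
  tm_letter_inj : injective tm_letter;
  tm_tapes : nat; (* the machine has [tm_tapes.+1] tapes *)
  tm_start : tm_state;
  tm_halt : pred tm_state;
  tm_trans : tm_state -> tm_tapes.+1.-tuple (option tm_sym) ->
             tm_state * tm_tapes.+1.-tuple (option tm_sym * move) }.

Definition config (M : machine) : Type :=
  tm_state M * (tm_tapes M).+1.-tuple (tape (tm_sym M)).

Definition tm_step (M : machine) (c : config M) : config M :=
  if tm_halt c.1 then c else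
  let: (q, acts) := tm_trans c.1 [tuple of map (@tape_head _) c.2] in
  (q, [tuple write_move (tnth c.2 i) (tnth acts i) | i < (tm_tapes M).+1]).

(* The input is on the first tape, all other tapes being blank. *)
Definition tm_init (M : machine) (w : seq symbol) : config M :=
  (tm_start M,
   [tuple if i == ord0 then word_tape (map (@tm_letter M) w)
          else blank_tape (tm_sym M) | i < (tm_tapes M).+1]).

(* The output is read on the last tape. *)
Definition computes_within (M : machine) (t : nat) (w w' : seq symbol) : Prop :=
  let c := iter t (@tm_step M) (tm_init M w) in
  tm_halt c.1 /\ tape_holds (tnth c.2 ord_max) (map (@tm_letter M) w').

(** * Polynomial-time many-one reductions *)

Definition polytime_computable (P Q : problem)
    (f : instance P -> instance Q) : Prop :=
  exists (M : machine) (p : {poly nat}), forall I : instance P,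
    computes_within M (p.[size (encode I)])%R (encode I) (encode (f I)).

Definition polytime_many_one_reducible (P Q : problem) : Prop :=
  exists f : instance P -> instance Q,
    polytime_computable f /\ forall I : instance P, yes I <-> yes (f I).

(* Main.v *)
Require Import Defs.
From mathcomp Require Import all_boot all_order all_algebra zify.

Set Implicit Arguments.
Unset Strict Implicit.
Unset Printing Implicit Defensive.

(** Let [C] be a cover of [G] with [|C| = k], and let [n] be the order of [G].
    Add to [G] a disjoint complete bipartite graph with sides [A] and [B] of
    size [n], and ask for a reconfiguration of [A u V(G)] into [B u V(G)] within
    the capacity [2n + k - 1]. When [B] is completed, the whole of [A] must still
    be in the cover, which leaves room for only [k - 1] vertices of [G];
    conversely a cover of [G] of size [k - 1] allows one to shrink [V(G)],
    exchange [A] for [B], and restore [V(G)] in at most [4n] steps. Only an upper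
    bound on the number of steps matters, so it is taken to be [2 ^ (4n)], whose
    binary notation is trivial to print.

    The Turing machine has an input tape, two unary counters of value [n] driving
    nested loops, a tape of marks, a one-cell flag and an output tape. The
    capacity is printed in binary by repeatedly deleting every other mark from a
    tape with [2n + k - 1] marks, the parity of the number of marks being the
    next bit. *)

(** * Structured programs for multi-tape machines *)

Section Routines.

Variable m : nat.

Local Notation tapes := (m.+1.-tuple (tape symbol)).
Local Notation cells := (m.+1.-tuple (option symbol)).
Local Notation actions := (m.+1.-tuple (option symbol * move)).

Definition heads (T : tapes) : cells := [tuple of map (@tape_head _) T].

Definition act_on (T : tapes) (a : actions) : tapes :=
  [tuple write_move (tnth T i) (tnth a i) | i < m.+1].

Definition idle (c : cells) : actions := [tuple (tnth c i, Stay) | i < m.+1].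

Lemma act_on_idle T : act_on T (idle (heads T)) = T.
Proof.
apply: eq_from_tnth => i; rewrite !(tnth_mktuple, tnth_map).
by case: (tnth T i).
Qed.

(* A routine leaves its set of states through the successor state [None]. *)
Record routine := Routine {
  rt_state : finType;
  rt_start : rt_state;
  rt_trans : rt_state -> cells -> option rt_state * actions }.

(** Leaving a routine is itself a step that writes and moves, hence the base case counts 1. *)
Inductive steps (r : routine) : nat -> rt_state r -> tapes -> tapes -> Prop :=
| StepsLast s T a :
    rt_trans s (heads T) = (None, a) -> steps 1 s T (act_on T a)
| StepsNext t s s' T T' a :
    rt_trans s (heads T) = (Some s', a) -> steps t s' (act_on T a) T' ->
    steps t.+1 s T T'.

Definition runs (r : routine) (t : nat) (T T' : tapes) :=
  exists2 t', t' <= t & steps t' (rt_start r) T T'.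

Lemma runs_leq r t u T T' : t <= u -> runs r t T T' -> runs r u T T'.
Proof. by move=> le_tu [t' le_t' St]; exists t' => //; apply: leq_trans le_tu. Qed.

Definition Do (f : cells -> actions) : routine :=
  @Routine unit tt (fun _ c => (None, f c)).

(** The last step of [r1] jumps directly to the start of [r2], so running times simply add up. *)
Definition Then (r1 r2 : routine) : routine :=
  @Routine (rt_state r1 + rt_state r2)%type (inl (rt_start r1))
    (fun s c => match s with
     | inl s1 => let: (s', a) := rt_trans s1 c in
                 (Some (if s' is Some s1' then inl s1' else inr (rt_start r2)), a)
     | inr s2 => let: (s', a) := rt_trans s2 c in (omap inr s', a)
     end).

(** State [None] performs the test, in one idle step; a body that leaves with [None] thus falls back
    on the test. *)
Definition While (b : pred cells) (r : routine) : routine :=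
  @Routine (option (rt_state r)) None
    (fun s c => match s with
     | None => (if b c then Some (Some (rt_start r)) else None, idle c)
     | Some s1 => let: (s', a) := rt_trans s1 c in (Some s', a)
     end).

Lemma runs_do f T : runs (Do f) 1 T (act_on T (f (heads T))).
Proof. by exists 1 => //; apply: StepsLast. Qed.

Lemma runs_then r1 r2 t1 t2 T T1 T2 :
  runs r1 t1 T T1 -> runs r2 t2 T1 T2 -> runs (Then r1 r2) (t1 + t2) T T2.
Proof.
case=> u1 le1 S1 [u2 le2 S2]; exists (u1 + u2); first exact: leq_add.
have {}S2: steps (r := Then r1 r2) u2 (inr (rt_start r2)) T1 T2.
  elim: S2 => [s T' a E|t s s' T' T'' a E _ IH].
    by apply: StepsLast; rewrite /= E.
  by apply: StepsNext IH; rewrite /= E.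
rewrite /=; elim: S1 S2 => {T T1 le1 u1} [s T a E|t s s' T T' a E _ IH] S2.
  by apply: StepsNext S2; rewrite /= E.
by rewrite addSn; apply: StepsNext (IH S2); rewrite /= E.
Qed.

Lemma runs_while_end (b : pred cells) r T : ~~ b (heads T) -> runs (While b r) 1 T T.
Proof.
move=> bF; exists 1 => //; rewrite -{2}[T]act_on_idle.
by apply: StepsLast; rewrite /= (negPf bF).
Qed.

Lemma runs_while_next (b : pred cells) r t u T T' T'' :
    b (heads T) -> runs r t T T' -> runs (While b r) u T' T'' ->
  runs (While b r) (t + u).+1 T T''.
Proof.
move=> bT [t' le_t S1] [u' le_u S2]; exists (t' + u').+1.
  by rewrite ltnS leq_add.
apply: (@StepsNext (While b r) _ None (Some (rt_start r)) _ _ (idle (heads T))).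
  by rewrite /= bT.
rewrite act_on_idle; elim: S1 S2 => {bT le_t t' T T'} [s T a E|k s s' T T' a E _ IH] S2.
  by apply: StepsNext S2; rewrite /= E.
by rewrite addSn; apply: StepsNext (IH S2); rewrite /= E.
Qed.

(** [X j] is the content of the tapes before pass [j]. Each pass pays one extra step for its test,
    and the final failing test pays one more. *)
Lemma runs_while (b : pred cells) r n t (X : nat -> tapes) :
    (forall j, j < n -> b (heads (X j)) /\ runs r t (X j) (X j.+1)) ->
    ~~ b (heads (X n)) ->
  runs (While b r) (n * t.+1).+1 (X 0) (X n).
Proof.
elim: n X => [|n IH] X HX HXn; first exact: runs_while_end.
have [b0 r0] := HX 0 isT.
rewrite mulSn addSn; have := IH (X \o succn) (fun j => HX j.+1) HXn.
by rewrite -addnS; apply: runs_while_next.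
Qed.

Definition machine_of (r : routine) : machine :=
  @Machine (option (rt_state r)) symbol id (@inj_id symbol) m (Some (rt_start r))
    (fun s => ~~ isSome s)
    (fun s c => if s is Some q then rt_trans q c else (None, idle c)).

Lemma machine_steps r t s T T' : @steps r t s T T' ->
  iter t (@tm_step (machine_of r)) (Some s, T) = (None, T').
Proof.
elim=> {t s T T'} [s T a E|t s s' T T' a E _ IH].
  by rewrite /= /tm_step /= E.
rewrite iterSr -IH; congr iter; rewrite /tm_step /=.
by rewrite [rt_trans s _]E.
Qed.

(** A halted configuration no longer changes, so an upper bound on the time can replace the exact
    number of iterations that [computes_within] prescribes. *)
Lemma machine_runs r t u T T' : runs r t T T' -> t <= u ->
  iter u (@tm_step (machine_of r)) (Some (rt_start r), T) = (None, T').
Proof.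
case=> t' le_t' S le_tu; rewrite -(subnK (leq_trans le_t' le_tu)) iterD.
by rewrite (machine_steps S); elim: (u - t') => //= k ->.
Qed.

End Routines.

(** * Loop programs driven by two unary counters *)

Local Notation cell := (option symbol).
Local Notation action := (cell * move)%type.
Local Notation "0s" := (Some false : symbol).
Local Notation "1s" := (Some true : symbol).
Local Notation "#s" := (None : symbol).

(* The head is on the first cell of [r]. *)
Definition mk_tape (l r : seq cell) : tape symbol :=
  Tape l (head None r) (behead r).

Record data := Data {
  input : tape symbol; marks : tape symbol; flag : tape symbol;
  output : tape symbol }.

(* Tapes 1 and 2 are the counters of the inner and the outer loops; [t] is the
   tape of the counter [b], and [u] that of the other one. *)
Definition store (b : bool) (t u : tape symbol) (x : data) :
    6.-tuple (tape symbol) :=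
  [tuple input x; if b then u else t; if b then t else u;
         marks x; flag x; output x].

Lemma act_on6 (T : 6.-tuple (tape symbol)) a0 a1 a2 a3 a4 a5 t0 t1 t2 t3 t4 t5 :
    T = [tuple t0; t1; t2; t3; t4; t5] ->
  act_on T [tuple a0; a1; a2; a3; a4; a5] =
  [tuple write_move t0 a0; write_move t1 a1; write_move t2 a2;
         write_move t3 a3; write_move t4 a4; write_move t5 a5].
Proof.
move=> ->; apply: eq_from_tnth => i; rewrite tnth_mktuple !(tnth_nth (t0)) /=.
by rewrite !(tnth_nth a0); case: i => [[|[|[|[|[|[|]]]]]]].
Qed.

Lemma write_stay (G : Type) (t : tape G) : write_move t (tape_head t, Stay) = t.
Proof. by case: t. Qed.

(** The counters are out of reach of an operation, which therefore behaves alike inside any loop. *)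
Definition operation := cell -> cell -> cell -> cell -> action * action * action * action.

Definition operate (h : operation) (x : data) : data :=
  let: (ai, ak, af, ao) :=
    h (tape_head (input x)) (tape_head (marks x)) (tape_head (flag x))
      (tape_head (output x)) in
  Data (write_move (input x) ai) (write_move (marks x) ak)
       (write_move (flag x) af) (write_move (output x) ao).

Definition Operate (h : operation) : routine 5 :=
  Do (fun c : 6.-tuple cell => let c i := nth None c i in
    let: (ai, ak, af, ao) := h (c 0) (c 3) (c 4) (c 5) in
    [tuple ai; (c 1, Stay); (c 2, Stay); ak; af; ao]).

Lemma runs_operate h b t u x :
  runs (Operate h) 1 (store b t u x) (store b t u (operate h x)).
Proof.
have := runs_do (fun c : 6.-tuple cell => let c i := nth None c i in
    let: (ai, ak, af, ao) := h (c 0) (c 3) (c 4) (c 5) in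
    [tuple ai; (c 1, Stay); (c 2, Stay); ak; af; ao]) (store b t u x).
rewrite /= /operate.
case: (h _ _ _ _) => [[[ai ak] af] ao].
by rewrite (act_on6 _ _ _ _ _ _ erefl) !write_stay.
Qed.

Definition Shift (b : bool) (mv : move) : routine 5 :=
  Do (fun c : 6.-tuple cell => let c i := nth None c i in
    [tuple (c 0, Stay); (c 1, if b then Stay else mv);
           (c 2, if b then mv else Stay); (c 3, Stay); (c 4, Stay); (c 5, Stay)]).

Lemma runs_shift b mv t u x :
  runs (Shift b mv) 1 (store b t u x)
    (store b (write_move t (tape_head t, mv)) u x).
Proof.
have := runs_do (fun c : 6.-tuple cell => let c i := nth None c i in
    [tuple (c 0, Stay); (c 1, if b then Stay else mv);
           (c 2, if b then mv else Stay); (c 3, Stay); (c 4, Stay); (c 5, Stay)])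
  (store b t u x).
rewrite /= (act_on6 _ _ _ _ _ _ erefl) !write_stay.
by case: b; rewrite /= write_stay.
Qed.

Definition on_mark (b : bool) (c : 6.-tuple cell) : bool :=
  nth None c (if b then 2 else 1) == Some 1s.

Lemma on_markE b t u x :
  on_mark b (heads (store b t u x)) = (tape_head t == Some 1s).
Proof. by case: b. Qed.

Definition Rewind (b : bool) : routine 5 :=
  Then (Shift b MoveLeft) (While (on_mark b) (Shift b MoveLeft)).

(** The position of rest: the head is on the blank before the [n] marks. Both bounding blanks are
    explicit, so that a traversal followed by a rewind restores the very same lists. *)
Definition counter (n : nat) : tape symbol :=
  mk_tape [::] (None :: rcons (nseq n (Some 1s)) None).

Lemma runs_rewind n b u x :
  runs (Rewind b) (2 * n + 2)
    (store b (mk_tape (rcons (nseq n (Some 1s)) None) [:: None]) u x)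
    (store b (counter n) u x).
Proof.
(* The tape when [j] marks are to the right of the head. *)
pose T j := mk_tape (behead (rcons (nseq (n - j) (Some 1s)) None))
   (head None (rcons (nseq (n - j) (Some 1s)) None) ::
      rcons (nseq j (Some 1s)) None).
apply: (@runs_leq _ _ (1 + (n * 2).+1)); first by lia.
apply: runs_then; first exact: runs_shift.
have := @runs_while _ (on_mark b) (Shift b MoveLeft) n 1 (fun j => store b (T j) u x).
rewrite /T /= subnn subn0; apply => [j lt_jn|].
  rewrite on_markE /= -(subnSK lt_jn) /=; split=> //.
  exact: runs_shift.
by rewrite on_markE.
Qed.

Definition Repeat (b : bool) (r : routine 5) : routine 5 :=
  Then (Shift b MoveRight)
    (Then (While (on_mark b) (Then r (Shift b MoveRight))) (Rewind b)).

(** The body is assumed correct for every content [t] of its loop's own counter tape, since it runs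
    while the head there is among the marks. *)
Lemma runs_repeat n b r c u (X : nat -> data) :
    (forall j t, j < n -> runs r c (store b t u (X j)) (store b t u (X j.+1))) ->
  runs (Repeat b r) ((c + 4) * n + 4)
    (store b (counter n) u (X 0)) (store b (counter n) u (X n)).
Proof.
move=> HX.
pose T j := mk_tape (rcons (nseq j (Some 1s)) None)
   (rcons (nseq (n - j) (Some 1s)) None).
apply: (@runs_leq _ _ (1 + ((n * (c + 1).+1).+1 + (2 * n + 2)))).
  by lia.
apply: runs_then; first exact: runs_shift.
apply: runs_then (runs_rewind n b u (X n)).
have := @runs_while _ (on_mark b) (Then r (Shift b MoveRight)) n (c + 1)
  (fun j => store b (T j) u (X j)).
rewrite /T /= subnn subn0; apply => [j lt_jn|]; last by rewrite on_markE.
rewrite on_markE /= -(subnSK lt_jn) /=; split=> //.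
by apply: runs_then (HX _ _ lt_jn) _; apply: runs_shift.
Qed.

(** * A language of nested loops and its running time *)

Inductive command :=
| Act (h : operation)
| Seq (c1 c2 : command)
| Loop (b : bool) (c : command).

Fixpoint compile (c : command) : routine 5 :=
  match c with
  | Act h => Operate h
  | Seq c1 c2 => Then (compile c1) (compile c2)
  | Loop b c => Repeat b (compile c)
  end.

Fixpoint den (n : nat) (c : command) : data -> data :=
  match c with
  | Act h => operate h
  | Seq c1 c2 => fun x => den n c2 (den n c1 x)
  | Loop _ c => iter n (den n c)
  end.

(** This is the exponent of [n.+1] in the running time. A positive depth also requires the inner
    counter to be at rest, and depth 2 the outer one too. *)
Fixpoint depth (c : command) : nat :=
  match c with
  | Act _ => 0
  | Seq c1 c2 => maxn (depth c1) (depth c2)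
  | Loop b _ => b.+1
  end.

(** The inner counter drives loop-free bodies only, and the outer one bodies with inner loops at
    most, so no counter is restarted while in use. *)
Fixpoint well_nested (c : command) : bool :=
  match c with
  | Act _ => true
  | Seq c1 c2 => well_nested c1 && well_nested c2
  | Loop b c => (depth c <= b) && well_nested c
  end.

Fixpoint cost (c : command) : nat :=
  match c with
  | Act _ => 1
  | Seq c1 c2 => cost c1 + cost c2
  | Loop _ c => cost c + 4
  end.

Lemma storeC b t u x : store (~~ b) t u x = store b u t x.
Proof. by case: b. Qed.

(** By induction on the command, with the counter tapes general because a body meets its loop's
    counter in mid-course. The 4 that a loop adds to [cost] absorbs the moves and tests counted in
    [runs_repeat]. *)
Lemma runs_compile n c t u x : well_nested c ->
    (0 < depth c -> t = counter n) -> (1 < depth c -> u = counter n) ->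
  runs (compile c) (cost c * n.+1 ^ depth c)
    (store false t u x) (store false t u (den n c x)).
Proof.
elim: c t u x => [h|c1 IH1 c2 IH2|b c IH] t u x;
  rewrite [depth _]/= [well_nested _]/= [cost _]/=.
- by move=> _ _ _; rewrite muln1; apply: runs_operate.
- case/andP=> wf1 wf2. rewrite !leq_max => Ht Hu; rewrite mulnDl.
  apply: runs_then.
  + have le1: n.+1 ^ depth c1 <= n.+1 ^ maxn (depth c1) (depth c2).
      by rewrite leq_pexp2l // leq_maxl.
    apply: runs_leq (IH1 t u x wf1 _ _); first by rewrite leq_mul2l le1 orbT.
      by move=> d1; apply: Ht; rewrite d1.
    by move=> d1; apply: Hu; rewrite d1.
  have le2: n.+1 ^ depth c2 <= n.+1 ^ maxn (depth c1) (depth c2).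
    by rewrite leq_pexp2l // leq_maxr.
  apply: runs_leq (IH2 t u _ wf2 _ _); first by rewrite leq_mul2l le2 orbT.
    by move=> d2; apply: Ht; rewrite d2 orbT.
  by move=> d2; apply: Hu; rewrite d2 orbT.
case/andP=> le_cb wfc Ht Hu; set B := cost c * n.+1 ^ b.
have le_time: (B + 4) * n + 4 <= (cost c + 4) * n.+1 ^ b.+1.
  by have: 0 < n.+1 ^ b; rewrite ?expn_gt0 // expnS /B; nia.
have le_B: cost c * n.+1 ^ depth c <= B by rewrite leq_mul2l leq_pexp2l ?orbT.
apply: runs_leq le_time _.
have {}Ht := Ht isT; subst t; case: b le_cb @B le_B Hu => le_cb B le_B Hu.
  have {}Hu := Hu isT; subst u.
  (* An outer loop works on the other counter; exchanging the roles of the two tapes gives the form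
     that [runs_repeat] expects. *)
  rewrite -!(storeC false) /=.
  apply: (@runs_repeat n true _ B (counter n) (fun j => iter j (den n c) x)) => j t _.
  apply: runs_leq le_B _; rewrite -!(storeC true).
  by apply: IH => // d1; have := leq_trans d1 le_cb.
apply: (@runs_repeat n false _ B u (fun j => iter j (den n c) x)) => j t _.
by apply: runs_leq le_B _; apply: IH => // d1; have := leq_trans d1 le_cb.
Qed.

(** * The program of the reduction *)

Definition emit (a : symbol) : operation := fun i k f _ =>
  ((i, Stay), (k, Stay), (f, Stay), (Some a, MoveRight)).

Definition copy : operation := fun i k f _ =>
  ((i, MoveRight), (k, Stay), (f, Stay), (i, MoveRight)).

Definition input_back : operation := fun i k f o =>
  ((i, MoveLeft), (k, Stay), (f, Stay), (o, Stay)).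

Definition add_mark : operation := fun i _ f o =>
  ((i, Stay), (Some 1s, MoveRight), (f, Stay), (o, Stay)).

Definition copy_mark : operation := fun i _ f o =>
  ((i, MoveRight), (i, MoveRight), (f, Stay), (o, Stay)).

Definition marks_back : operation := fun i k f o =>
  ((i, Stay), (k, MoveLeft), (f, Stay), (o, Stay)).

Definition transduce (d : cell -> cell -> cell * cell) : operation := fun i k f o =>
  ((i, Stay), ((d f k).2, MoveRight), ((d f k).1, Stay), (o, Stay)).

Definition reset : operation := fun i k _ o =>
  ((i, Stay), (k, Stay), (None, Stay), (o, Stay)).

(** A blank flag prints nothing, so rounds of halving beyond the last digit are harmless. *)
Definition flush : operation := fun i k f o =>
  ((i, Stay), (k, Stay), (None, Stay),
   if f is Some a then (Some a, MoveRight) else (o, Stay)).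

(** [p] is the part of the input already read and [q] the rest; [s] and [w] stand to the left of the
    heads on the tape of marks and on the output tape. *)
Definition situation (p q : seq symbol) (s : seq cell) (f : cell)
    (w : seq symbol) : data :=
  Data (mk_tape (rev (map Some p)) (map Some q)) (mk_tape (rev s) [:: None])
       (mk_tape [::] [:: f]) (mk_tape (rev (map Some w)) [::]).

Section Situations.

Variables (p : seq symbol) (s : seq cell) (f : cell).
Implicit Types (q r w : seq symbol).

Lemma emitE q w a :
  operate (emit a) (situation p q s f w) = situation p q s f (rcons w a).
Proof. by rewrite /situation /operate /= map_rcons rev_rcons. Qed.

Lemma copyE a q w :
  operate copy (situation p (a :: q) s f w) =
  situation (rcons p a) q s f (rcons w a).
Proof. by rewrite /situation /operate /= !map_rcons !rev_rcons. Qed.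

Lemma add_markE q w :
  operate add_mark (situation p q s f w) =
  situation p q (rcons s (Some 1s)) f w.
Proof.
by rewrite /situation /operate rev_rcons.
Qed.

Lemma copy_markE a q w :
  operate copy_mark (situation p (a :: q) s f w) =
  situation (rcons p a) q (rcons s (Some a)) f w.
Proof. by rewrite /situation /operate /= !map_rcons !rev_rcons. Qed.

Lemma flushE q w :
  operate flush (situation p q s f w) =
  situation p q s None (if f is Some a then rcons w a else w).
Proof.
rewrite /situation /operate /=; case: f => [a|] /=.
  by rewrite map_rcons rev_rcons.
by [].
Qed.

Lemma iter_append n (g : data -> data) q u w :
    (forall w, g (situation p q s f w) = situation p q s f (w ++ u)) ->
  iter n g (situation p q s f w) = situation p q s f (w ++ flatten (nseq n u)).
Proof.
move=> gE; elim: n w => [|n IH] w; first by rewrite cats0.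
by rewrite iterSr gE IH -catA.
Qed.

Lemma iter_emit n q a w :
  iter n (operate (emit a)) (situation p q s f w) =
  situation p q s f (w ++ nseq n a).
Proof.
rewrite (@iter_append n _ q [:: a]); last by move=> u; rewrite emitE cats1.
by congr (situation _ _ _ _ (_ ++ _)); elim: n => //= n ->.
Qed.

End Situations.

Lemma iter_read (g : data -> data) (D : seq symbol -> bool)
    (F : seq symbol -> seq symbol) s f :
    (forall p q w r, D r -> g (situation p (r ++ q) s f w) =
                            situation (p ++ r) q s f (w ++ F r)) ->
  forall n rs p q w, size rs = n -> all D rs ->
  iter n g (situation p (flatten rs ++ q) s f w) =
  situation (p ++ flatten rs) q s f (w ++ flatten (map F rs)).
Proof.
move=> gE n rs p q w <-; elim: rs p w => [|r rs IH] p w /=; first by rewrite !cats0.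
case/andP=> Dr Drs; rewrite -catA -iterS iterSr gE // IH //.
by rewrite -!catA.
Qed.

Lemma iter_copy n s f r p q w : size r = n ->
  iter n (operate copy) (situation p (r ++ q) s f w) =
  situation (p ++ r) q s f (w ++ r).
Proof.
move=> <-; elim: r p w => [|a r IH] p w; first by rewrite !cats0.
by rewrite iterSr copyE IH !cat_rcons.
Qed.

Lemma iter_add_mark n p q s f w :
  iter n (operate add_mark) (situation p q s f w) =
  situation p q (s ++ nseq n (Some 1s)) f w.
Proof.
elim: n s => [|n IH] s; first by rewrite cats0.
by rewrite iterSr add_markE IH cat_rcons.
Qed.

Lemma iter_copy_mark n s f r p q w : size r = n ->
  iter n (operate copy_mark) (situation p (r ++ q) s f w) =
  situation (p ++ r) q (s ++ map Some r) f w.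
Proof.
move=> <-; elim: r p s => [|a r IH] p s; first by rewrite !cats0.
by rewrite iterSr copy_markE IH !cat_rcons.
Qed.

(** * Transducer sweeps over the tape of marks *)

(** A one-way finite transducer whose state is the content of the flag; [d] returns the new flag and
    the replacement of the cell. *)
Fixpoint scan (d : cell -> cell -> cell * cell) (f : cell) (s : seq cell) :
    cell * seq cell :=
  if s is a :: s' then
    let r := scan d (d f a).1 s' in (r.1, (d f a).2 :: r.2)
  else (f, [::]).

Lemma size_scan d f s : size (scan d f s).2 = size s.
Proof. by elim: s f => //= a s IH f; rewrite IH. Qed.

Lemma iter_marks_back i f o s r :
  iter (size s) (operate marks_back) (Data i (mk_tape (rev s) (None :: r)) f o) =
  Data i (mk_tape [::] (s ++ None :: r)) f o.
Proof.
(* The cells [s2] already passed are made explicit, for an induction on those still to the left of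
   the head. *)
suff: forall s1 s2, iter (size s1) (operate marks_back)
     (Data i (mk_tape (rev s1) (s2 ++ None :: r)) f o) =
     Data i (mk_tape [::] (s1 ++ s2 ++ None :: r)) f o by move/(_ s [::]).
elim/last_ind=> [|s1 a IH] s2 //.
rewrite size_rcons iterSr cat_rcons -(IH (a :: s2)) rev_rcons /operate /= !write_stay.
by case: s2.
Qed.

Lemma iter_transduce d i f o l s r :
  iter (size s) (operate (transduce d))
    (Data i (mk_tape l (s ++ r)) (mk_tape [::] [:: f]) o) =
  Data i (mk_tape (rev (scan d f s).2 ++ l) r) (mk_tape [::] [:: (scan d f s).1]) o.
Proof.
elim: s l f => [|a s IH] l f //.
have step:
  operate (transduce d) (Data i (mk_tape l ((a :: s) ++ r)) (mk_tape [::] [:: f]) o) =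
  Data i (mk_tape ((d f a).2 :: l) (s ++ r)) (mk_tape [::] [:: (d f a).1]) o.
  by rewrite /operate /= !write_stay.
by rewrite iterSr step IH /= rev_cons cat_rcons.
Qed.

Notation "c1 ;; c2" := (Seq c1 c2) (at level 60, right associativity).

Definition blocks (h1 h2 h3 : operation) : command :=
  Loop false (Act h1) ;; Loop false (Act h2) ;; Loop false (Act h3).

(** Sweeps are run on [3 * n] cells, a number that erasing marks does not change: three loops of
    length [n] go back to the beginning and three more traverse the tape. *)
Definition sweep (d : cell -> cell -> cell * cell) : command :=
  blocks marks_back marks_back marks_back ;;
  blocks (transduce d) (transduce d) (transduce d).

Lemma sweepE n d p q s f w : size s = 3 * n ->
  den n (sweep d) (situation p q s f w) =
  situation p q (scan d f s).2 (scan d f s).1 w.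
Proof.
move=> size_s.
have blocksE h x : den n (blocks h h h) x = iter (size s) (operate h) x.
  by rewrite size_s /= -!iterD; congr iter; lia.
rewrite -[LHS]/(den n (blocks _ _ _) (den n (blocks _ _ _) _)) !blocksE.
by rewrite /situation iter_marks_back iter_transduce cats0.
Qed.

(** Only the first mark is erased, which accounts for the [- 1] in the capacity; the letter [#s] in
    the flag records that this is done. *)
Definition skip (f k : cell) : cell * cell :=
  if (k == Some 1s) && (f == None) then (Some #s, Some 0s) else (f, k).

(* The flag is blank until a mark is met; it then holds the parity of the
   number of marks met. Every other mark, from the first one on, is erased. *)
Definition halve (f k : cell) : cell * cell :=
  if k == Some 1s then
    if f == Some 1s then (Some 0s, k) else (Some 1s, Some 0s)
  else (f, k).

Lemma scan_skip s :
  count_mem (Some 1s) (scan skip None s).2 = (count_mem (Some 1s) s).-1.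
Proof.
have skipped: forall s, (scan skip (Some #s) s).2 = s.
  by elim=> //= a r IH; rewrite /skip andbF IH.
elim: s => //= a s IH; rewrite /skip andbT.
by case Ha: (a == Some 1s); rewrite /= ?skipped ?Ha ?IH.
Qed.

Lemma scan_halve s :
  let c := count_mem (Some 1s) s in
  scan halve None s =
    (if c == 0 then None else Some (Some (odd c)), (scan halve None s).2) /\
  count_mem (Some 1s) (scan halve None s).2 = c./2.
Proof.
(* Once a mark has been met, the flag [b] stands for the number, 0 or 1, of erased marks still
   waiting for a partner. The first mark leads from the blank flag to [b = true]. *)
have seen: forall (b : bool) s, let c := b + count_mem (Some 1s) s in
    (scan halve (Some (Some b)) s).1 = Some (Some (odd c)) /\
    count_mem (Some 1s) (scan halve (Some (Some b)) s).2 = c./2.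
  move=> b {}s; elim: s b => [|a s IH] b /=; first by rewrite addn0; case: b.
  rewrite /halve; case Ha: (a == Some 1s) => /=; last first.
    by rewrite Ha; apply: IH.
  case: b => /=; first by have [-> ->] := IH false; rewrite Ha /= negbK.
  by have [-> ->] := IH true.
elim: s => //= a s [IH1 IH2]; rewrite /halve.
case Ha: (a == Some 1s) => /=; last by rewrite Ha IH2 {1}IH1.
by have [-> ->] := seen true s.
Qed.

(** * Binary notation by repeated halving *)

Fixpoint bits (j m : nat) : seq symbol :=
  if j is j'.+1 then if m == 0 then [::] else Some (odd m) :: bits j' m./2
  else [::].

(** Each halving drops the lowest digit, so [j] rounds exhaust any number below [2 ^ j]. *)
Lemma bits_enc j m : 0 < m < 2 ^ j -> rcons (bits j m) #s = enc_nat m.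
Proof.
move=> Hm; congr rcons; elim: j m Hm => [|j IH] m; first by case: m.
case/andP=> m_gt0 lt_m; rewrite /= eqn0Ngt m_gt0 /=.
have [->|m_gt1] : m = 1 \/ 1 < m by lia.
  by rewrite trunc_log1 /=; case: (j).
rewrite (@IH m./2); last by rewrite expnS in lt_m; lia.
rewrite (trunc_log2S m_gt1) /mkseq [in RHS]/= divn1; congr (_ :: _).
rewrite (iotaDl 1 1) -map_comp; apply: eq_map => i /=.
by rewrite add1n expnS divnMA divn2.
Qed.

Lemma enc_pow2 j : enc_nat (2 ^ j) = nseq j 0s ++ [:: 1s; #s].
Proof.
rewrite /enc_nat trunc_expnK // mkseqS divnn expn_gt0 /=.
rewrite -!cats1 -catA; congr (_ ++ _).
have -> : nseq j 0s = [seq 0s | i <- iota 0 j] by elim: j 0 => //= j IH i; rewrite -IH.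
apply/eq_in_map => i; rewrite mem_iota add0n /= => lt_ij.
by rewrite -expnB ?(ltnW lt_ij) // oddX eqn0Ngt subn_gt0 lt_ij.
Qed.

(** * The code that prints the reconfiguration instance *)

(** The three blocks match the three parts of the gadget, of [n] vertices each, and [d] ends the
    row. *)
Definition row (a b c : operation) (d : operation) : command :=
  blocks a b c ;; Act d.

(** The rows of [A], of [B] and of the old vertices, in this order; the last kind copies the input
    rows with their separators, and the final [copy] prints the letter that ends the matrix. *)
Definition graph_code : command :=
  Loop true (row (emit 0s) (emit 1s) (emit 0s) (emit #s)) ;;
  Loop true (row (emit 1s) (emit 0s) (emit 0s) (emit #s)) ;;
  Loop true (row (emit 0s) (emit 0s) copy copy) ;;
  Act copy.

Definition sets_code : command :=
  row (emit 1s) (emit 0s) (emit 1s) (emit #s) ;;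
  row (emit 0s) (emit 1s) (emit 1s) (emit #s).

Definition digits_code : command :=
  Loop true (sweep halve ;; Act flush).

(** The tape of marks receives [2 * n] marks, then the characteristic vector of the cover, whose
    bits 1 are marks as well. Each [digits_code] makes [n] rounds of halving. *)
Definition numbers_code : command :=
  row add_mark add_mark copy_mark reset ;;
  sweep skip ;; Act reset ;;
  digits_code ;; digits_code ;; Act (emit #s) ;;
  Loop false (Act (emit 0s) ;; Act (emit 0s) ;; Act (emit 0s) ;; Act (emit 0s)) ;;
  Act (emit 1s) ;; Act (emit #s).

Definition line (n : nat) (a b c : symbol) : seq symbol :=
  nseq n a ++ nseq n b ++ nseq n c ++ [:: #s].

Lemma row_emitE n a b c p q s f w :
  den n (row (emit a) (emit b) (emit c) (emit #s)) (situation p q s f w) =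
  situation p q s f (w ++ line n a b c).
Proof.
rewrite -[LHS]/(operate (emit #s) (iter n (operate (emit c))
  (iter n (operate (emit b)) (iter n (operate (emit a)) _)))).
by rewrite !iter_emit emitE -cats1 -!catA.
Qed.

Lemma graph_codeE n rows q s f w :
    size rows = n -> all (fun r => size r == n.+1) rows ->
  exists p, den n graph_code (situation [::] (flatten rows ++ #s :: q) s f w) =
  situation p q s f
    (w ++ flatten (nseq n (line n 0s 1s 0s)) ++ flatten (nseq n (line n 1s 0s 0s)) ++
     flatten [seq nseq n 0s ++ nseq n 0s ++ r | r <- rows] ++ [:: #s]).
Proof.
move=> size_rows Hrows; exists (rcons (flatten rows) #s).
rewrite -[LHS]/(operate copy (iter n (den n (row (emit 0s) (emit 0s) copy copy))
  (iter n (den n (row (emit 1s) (emit 0s) (emit 0s) (emit #s)))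
     (iter n (den n (row (emit 0s) (emit 1s) (emit 0s) (emit #s))) _)))).
rewrite (@iter_append _ _ _ _ _ _ (line n 0s 1s 0s)); last by move=> u; apply: row_emitE.
rewrite (@iter_append _ _ _ _ _ _ (line n 1s 0s 0s)); last by move=> u; apply: row_emitE.
rewrite (@iter_read _ (fun r => size r == n.+1)
                      (fun r => nseq n 0s ++ nseq n 0s ++ r)) //.
  by rewrite copyE -!cats1 -!catA.
move=> p q' w'; elim/last_ind => // r a _; rewrite size_rcons eqSS => /eqP size_r.
rewrite -[LHS]/(operate copy (iter n (operate copy)
  (iter n (operate (emit 0s)) (iter n (operate (emit 0s)) _)))).
by rewrite !iter_emit cat_rcons iter_copy // copyE -!cats1 -!catA.
Qed.

Lemma sets_codeE n p q s f w :
  den n sets_code (situation p q s f w) =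
  situation p q s f (w ++ line n 1s 0s 1s ++ line n 0s 1s 1s).
Proof.
rewrite -[LHS]/(den n (row _ _ _ _) (den n (row _ _ _ _) _)).
by rewrite !row_emitE catA.
Qed.

Lemma iter_sweep n j p q s w : size s = 3 * n ->
  exists s', iter j (den n (sweep halve ;; Act flush)) (situation p q s None w) =
    situation p q s' None (w ++ bits j (count_mem (Some 1s) s)).
Proof.
elim: j s w => [|j IH] s w size_s; first by exists s; rewrite cats0.
rewrite iterSr -[den n (_ ;; _) _]/(operate flush (den n (sweep halve) _)).
rewrite sweepE // flushE; have [E1 E2] := scan_halve s.
have [s' ->] := IH (scan halve None s).2
  (if (scan halve None s).1 is Some a then rcons w a else w)
  (etrans (size_scan _ _ _) size_s).
exists s'; congr (situation _ _ _ _ _); rewrite E2 E1 /=.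
case: (_ =P 0) => [->|_]; last by rewrite cat_rcons.
by case: (j).
Qed.

Lemma numbers_codeE n p q c w :
    0 < n -> size c = n -> 0 < count_mem 1s c ->
  exists p' s', den n numbers_code (situation p (c ++ q) [::] None w) =
  situation p' q s' None
    (w ++ enc_nat (2 * n + count_mem 1s c - 1) ++ enc_nat (2 ^ (4 * n))).
Proof.
move=> n_gt0 size_c c_gt0; set k := count_mem 1s c in c_gt0 *.
have le_kn: k <= n by rewrite -size_c count_size.
pose s := nseq n (Some 1s) ++ nseq n (Some 1s) ++ map Some c.
have count_s: count_mem (Some 1s) s = 2 * n + k.
  rewrite !count_cat count_nseq count_map /=.
  have -> : count (preim Some (pred1 (Some 1s))) c = k by apply: eq_count.
  by lia.
have size_s: size s = 3 * n by rewrite !size_cat !size_nseq size_map; lia.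
pose s1 := (scan skip None s).2.
have size_s1: size s1 = 3 * n by rewrite size_scan.
have count_s1: count_mem (Some 1s) s1 = 2 * n + k - 1.
  by rewrite scan_skip count_s subn1.
have [s2 E2] := @iter_sweep n (n + n) (p ++ c) q s1 w size_s1.
exists (p ++ c), s2.
rewrite -[LHS]/(operate (emit #s) (operate (emit 1s) (iter n
    (den n (Act (emit 0s) ;; Act (emit 0s) ;; Act (emit 0s) ;; Act (emit 0s)))
   (operate (emit #s) (iter n (den n (sweep halve ;; Act flush))
     (iter n (den n (sweep halve ;; Act flush))
   (operate reset (den n (sweep skip) (operate reset (iter n (operate copy_mark)
     (iter n (operate add_mark) (iter n (operate add_mark) _)))))))))))).
rewrite !iter_add_mark iter_copy_mark // -catA -/s.
have resetE p' q' s' f' w' : operate reset (situation p' q' s' f' w') =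
    situation p' q' s' None w'.
  by [].
rewrite resetE sweepE // resetE -/s1 -iterD E2 emitE.
rewrite (@iter_append _ _ _ _ _ _ (nseq 4 0s)); last first.
  by move=> u; rewrite /= !emitE -!cats1 -!catA.
rewrite !emitE; congr (situation _ _ _ _ _).
rewrite -!cats1 -!catA; congr (_ ++ _).
have -> : flatten (nseq n (nseq 4 0s)) = nseq (4 * n) 0s.
  by elim: (n) => // m IH; rewrite mulnS nseqD -IH.
rewrite enc_pow2 catA cats1 count_s1 bits_enc //.
apply/andP; split; first lia.
(* The two runs of [digits_code] make [2 * n] rounds, enough for a capacity of at most [3 * n]
   because [3 * n < 4 ^ n] for positive [n]. *)
apply: (@leq_ltn_trans (3 * n)); first lia.
rewrite addnn -mul2n expnM -[2 ^ 2]/4; elim: (n) n_gt0 => // -[|m] IH _ //.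
by have := IH isT; rewrite (expnS 4 m.+1); lia.
Qed.

Definition main_code : command :=
  Loop false (Act input_back) ;; graph_code ;; sets_code ;; numbers_code.

Definition row_word (r : seq bool) : seq symbol := rcons (map Some r) #s.

Definition output_word (n : nat) (R : seq (seq bool)) (c : seq bool) :=
  (flatten (nseq n (line n 0s 1s 0s)) ++ flatten (nseq n (line n 1s 0s 0s)) ++
     flatten [seq nseq n 0s ++ nseq n 0s ++ row_word r | r <- R] ++ [:: #s]) ++
  (line n 1s 0s 1s ++ line n 0s 1s 1s) ++
  enc_nat (2 * n + count id c - 1) ++ enc_nat (2 ^ (4 * n)).

Lemma iter_input_back n p a q s f w : size p = n ->
  iter n (operate input_back) (situation p (a :: q) s f w) =
  situation [::] (p ++ a :: q) s f w.
Proof.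
move=> <-; elim/last_ind: p a q => // p b IH a q; rewrite size_rcons iterSr cat_rcons -IH.
by rewrite /situation /operate /= map_rcons rev_rcons.
Qed.

(** The input head starts just after the bits of the first row, where the initialisation of the
    counters leaves it; [input_back] brings it back to the start. *)
Lemma main_codeE n r R c :
    0 < n -> size r = n -> size R = n.-1 -> all (fun r => size r == n) R ->
    size c = n -> has id c ->
  exists p s q,
    den n main_code (situation (map Some r)
       (#s :: flatten (map row_word R) ++ #s :: row_word c) [::] None [::]) =
    situation p q s None (output_word n (r :: R) c).
Proof.
move=> n_gt0 size_r size_R HR size_c Hc.
rewrite -[den n _ _]/(den n numbers_code (den n sets_code (den n graph_code
  (iter n (operate input_back) _)))).
rewrite iter_input_back ?size_map //.
have -> : map Some r ++ #s :: flatten (map row_word R) ++ #s :: row_word c =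
    flatten (map row_word (r :: R)) ++ #s :: row_word c.
   by rewrite /= -catA cat_rcons.
have [||p ->] := @graph_codeE n (map row_word (r :: R)) (row_word c) [::] None [::].
- by rewrite size_map /= size_R prednK.
- rewrite all_map /= size_rcons size_map size_r eqxx.
  by apply: sub_all HR => r' /= /eqP; rewrite size_rcons size_map => ->.
rewrite sets_codeE (_ : row_word c = map Some c ++ [:: #s]); last by rewrite cats1.
set w := (W in situation _ _ _ _ W).
have countE: count_mem 1s (map Some c) = count id c.
  by rewrite count_map; apply: eq_count => -[].
have [||p' [s' ->]] := @numbers_codeE n p [:: #s] (map Some c) w n_gt0.
- by rewrite size_map.
- by rewrite countE -has_count.
by exists p', s', [:: #s]; rewrite countE /w -map_comp /output_word -!catA.
Qed.

(** * The complete machine *)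

Definition output_back : operation := fun i k f o =>
  ((i, Stay), (k, Stay), (f, Stay), (o, MoveLeft)).

Definition output_next : operation := fun i k f o =>
  ((i, Stay), (k, Stay), (f, Stay), (o, MoveRight)).

Definition on_output (c : 6.-tuple cell) : bool := nth None c 5 != None.

(** The order [n] is found as the number of bits in the first row, each of which puts a mark on both
    counters. *)
Definition read_bit (c : 6.-tuple cell) : 6.-tuple action :=
  let c i := nth None c i in
  [tuple (c 0, MoveRight); (Some 1s, MoveRight); (Some 1s, MoveRight);
         (c 3, Stay); (c 4, Stay); (c 5, Stay)].

Definition on_bit (c : 6.-tuple cell) : bool :=
  if nth None c 0 is Some (Some _) then true else false.

(** [tape_holds] wants the head on the first letter, so the output is walked back to the blank
    before it, then one cell forward. *)
Definition Finish : routine 5 :=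
  Then (Operate output_back)
    (Then (While on_output (Operate output_back)) (Operate output_next)).

(** The first two shifts leave a blank before the marks of each counter, where [Rewind] stops. *)
Definition reducer : routine 5 :=
  Then (Shift false MoveRight) (Then (Shift true MoveRight)
    (Then (While on_bit (Do read_bit))
      (Then (Rewind false) (Then (Rewind true)
        (Then (compile main_code) Finish))))).

Lemma runs_finish b t u p q s f w :
  exists x, runs Finish (2 * size w + 3)
              (store b t u (situation p q s f w)) (store b t u x) /\
            tape_holds (output x) w.
Proof.
set i := mk_tape (rev (map Some p)) (map Some q).
set k := mk_tape (rev s) [:: None]; set g := mk_tape [::] [:: f].
exists (Data i k g (mk_tape [:: None] (map Some w ++ [:: None]))); split; last first.
  by exists 1, 1; split=> //; case: w.
apply: (@runs_leq _ _ (1 + ((2 * size w).+1 + 1))); first by lia.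
apply: runs_then; first exact: runs_operate.
have -> : operate output_back (situation p q s f w) =
    Data i k g (mk_tape (behead (rev (map Some w)))
                        (head None (rev (map Some w)) :: [:: None])).
  by [].
have loop l r : runs (While on_output (Operate output_back)) (2 * size l).+1
    (store b t u (Data i k g (mk_tape (behead (map Some l))
                              (head None (map Some l) :: r))))
    (store b t u (Data i k g (mk_tape [::] (None :: map Some (rev l) ++ r)))).
  elim: l r => [|a l IH] r; first exact: runs_while_end.
  apply: (@runs_leq _ _ (1 + (2 * size l).+1).+1); first by rewrite /=; lia.
  apply: runs_while_next; [by [] | exact: runs_operate |].
  rewrite rev_cons map_rcons cat_rcons.
  by have := IH (Some a :: r).
have next := runs_operate output_next b t u
  (Data i k g (mk_tape [::] (None :: map Some w ++ [:: None]))).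
apply: runs_then next.
by have := loop (rev w) [:: None]; rewrite size_rev revK map_rev.
Qed.

Lemma runs_reducer n r R c :
    0 < n -> size r = n -> size R = n.-1 -> all (fun r => size r == n) R ->
    size c = n -> has id c ->
  exists t u x,
    runs reducer
      (cost main_code * n.+1 ^ 2 + 6 * n +
       2 * size (output_word n (r :: R) c) + 10)
      (store false (blank_tape symbol) (blank_tape symbol)
        (situation [::] (flatten (map row_word (r :: R)) ++ #s :: row_word c)
           [::] None [::]))
      (store false t u x) /\
    tape_holds (output x) (output_word n (r :: R) c).
Proof.
move=> n_gt0 size_r size_R HR size_c Hc.
have [p [s [q Hmain]]] := main_codeE n_gt0 size_r size_R HR size_c Hc.
set w := output_word _ _ _ in Hmain *.
have [x [Hfin Hx]] := runs_finish false (counter n) (counter n) p q s None w.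
exists (counter n), (counter n), x; split=> //.
set rest := #s :: flatten (map row_word R) ++ #s :: row_word c in Hmain.
have -> : flatten (map row_word (r :: R)) ++ #s :: row_word c = map Some r ++ rest.
  by rewrite /= -catA cat_rcons.
(* [T j] is either counter, and [X j] the other tapes, after [j] bits of the first row. *)
pose T j := mk_tape (rcons (nseq j (Some 1s)) None) [:: None].
pose X j := situation (take j (map Some r)) (drop j (map Some r) ++ rest) [::] None [::].
apply: (@runs_leq _ _ (1 + (1 + ((n * 2).+1 + ((2 * n + 2) + ((2 * n + 2) +
   (cost main_code * n.+1 ^ 2 + (2 * size w + 3)))))))); first by lia.
apply: runs_then; first exact: runs_shift.
apply: runs_then; first exact: (@runs_shift true).
have Hread := @runs_while _ on_bit (Do read_bit) n 1
  (fun j => store false (T j) (T j) (X j)).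
rewrite /T /X take0 drop0 /= in Hread.
apply: runs_then.
  apply: Hread => [j lt_jn|].
    rewrite (drop_nth None) ?size_map ?size_r // (nth_map false) ?size_r //.
    rewrite (take_nth None) ?size_map ?size_r // (nth_map false) ?size_r //.
    split=> //.
    set a := nth _ _ _. set p1 := take _ _. set q1 := drop _ _.
    have := runs_do read_bit (store false (T j) (T j)
      (situation p1 ((Some a :: q1) ++ rest) [::] None [::])).
    rewrite /= (act_on6 _ _ _ _ _ _ erefl).
    by rewrite /situation map_rcons rev_rcons; apply: runs_leq.
  by rewrite drop_oversize ?size_map ?size_r.
apply: runs_then; first exact: runs_rewind.
apply: runs_then; first exact: (@runs_rewind _ true).
rewrite take_oversize ?drop_oversize ?size_map ?size_r //.
apply: runs_then Hfin; rewrite -Hmain.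
exact: (@runs_compile n main_code (counter n) (counter n) _ isT
          (fun=> erefl) (fun=> erefl)).
Qed.

(** * Correctness of the reduction *)

Section Reconfiguration.

Variables (G : graph) (k : nat).
Implicit Types X Y : {set vertices G}.

Lemma is_coverS X Y : X \subset Y -> is_cover X -> is_cover Y.
Proof.
move=> sXY /forallP cX; apply/forallP=> u; apply/forallP=> v; apply/implyP=> uv.
have /forallP/(_ v)/implyP/(_ uv) := cX u.
by case/orP=> /(subsetP sXY) ->; rewrite ?orbT.
Qed.

Lemma reconfigurable_trans l1 l2 X Y Z :
  reconfigurable k l1 X Y -> reconfigurable k l2 Y Z ->
  reconfigurable k (l1 + l2) X Z.
Proof.
case=> s1 [le1 p1 e1] [s2 [le2 p2 e2]]; exists (s1 ++ s2).
by rewrite size_cat leq_add // cat_path p1 e1 p2 last_cat e1.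
Qed.

Lemma reconfigurable_leq l1 l2 X Y :
  l1 <= l2 -> reconfigurable k l1 X Y -> reconfigurable k l2 X Y.
Proof. by move=> le [s [le1 ? ?]]; exists s; split=> //; apply: leq_trans le. Qed.

(** Vertices are added one at a time: every intermediate set contains the cover [X] and lies within
    [Y]. *)
Lemma reconfigurable_grow X Y : is_cover X -> X \subset Y -> #|Y| <= k ->
  reconfigurable k #|Y :\: X| X Y.
Proof.
move=> + + leYk; move cE: #|Y :\: X| => c.
elim: c X cE => [|c IH] X cE cX sXY.
  exists [::]; split=> //=; apply/eqP; rewrite eqEsubset sXY -setD_eq0.
  by rewrite -cards_eq0 cE.
have /card_gt0P[v] : 0 < #|Y :\: X| by rewrite cE.
rewrite inE => /andP[vX vY].
have sX'Y: v |: X \subset Y by rewrite subUset sub1set vY.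
have cX': is_cover (v |: X) by apply: is_coverS cX; apply: subsetUr.
have [|s [le_s ps es]] := IH (v |: X) _ cX' sX'Y.
  by move: cE; rewrite (cardsD1 v) !inE vX vY setDDl [X :|: _]setUC => -[].
exists ((v |: X) :: s); split=> //=; rewrite ps andbT /reconf_step cX' /=.
rewrite (leq_trans (subset_leq_card sX'Y)) // andbT.
by apply/existsP; exists v; rewrite vX eqxx.
Qed.

Lemma reconfigurable_shrink X Y : is_cover X -> X \subset Y -> #|Y| <= k ->
  reconfigurable k #|Y :\: X| Y X.
Proof.
move=> cX; move cE: #|Y :\: X| => c.
elim: c Y cE => [|c IH] Y cE sXY leYk.
  exists [::]; split=> //=; apply/eqP; rewrite eqEsubset sXY -setD_eq0.
  by rewrite -cards_eq0 cE.
have /card_gt0P[v] : 0 < #|Y :\: X| by rewrite cE.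
rewrite inE => /andP[vX vY].
have sXY': X \subset Y :\ v by rewrite subsetD1 sXY.
have leY'k: #|Y :\ v| <= k by apply: leq_trans leYk; rewrite subset_leq_card ?subD1set.
have [|s [le_s ps es]] := IH (Y :\ v) _ sXY' leY'k.
  by move: cE; rewrite (cardsD1 v) !inE vX vY !setDDl [X :|: _]setUC => -[].
exists ((Y :\ v) :: s); split=> //=; rewrite ps andbT /reconf_step leY'k.
rewrite (is_coverS sXY' cX) !andbT.
by apply/existsP; exists v; rewrite vY eqxx orbT.
Qed.

(** A discrete intermediate value principle, meant for the property of containing the whole side
    [B]. *)
Lemma path_crossing (P : pred {set vertices G}) S s :
    is_cover S -> path (@reconf_step G k) S s -> ~~ P S -> P (last S s) ->
  exists X Y, [/\ is_cover X, reconf_step k X Y, ~~ P X & P Y].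
Proof.
elim: s S => [|Y s IH] S cS /=; first by move=> _ /negPf ->.
case/andP=> st ps nPS Pl; case PY: (P Y); first by exists S, Y.
by apply: (IH Y) => //; [case/and3P: st | rewrite PY].
Qed.

End Reconfiguration.

(** Serves to pad a cover to a prescribed size. *)
Lemma card_superset (T : finType) (A : {set T}) m :
  #|A| <= m <= #|T| -> exists2 B : {set T}, A \subset B & #|B| = m.
Proof.
case/andP=> leAm lemT; have [B] : exists B : {set T}, A \subset B /\ #|B| = m.
  elim: m leAm lemT => [|m IH]; first by rewrite leqn0 => /eqP ? _; exists A.
  rewrite leq_eqVlt => /orP[/eqP <-|]; first by exists A.
  rewrite ltnS => leAm ltmT; have [B [sAB cB]] := IH leAm (ltnW ltmT).
  have /card_gt0P[v] : 0 < #|~: B| by rewrite cardsCs setCK cB subn_gt0.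
  rewrite inE => vB; exists (v |: B); rewrite cardsU1 vB cB; split=> //.
  exact: subset_trans sAB (subsetUr _ _).
by case=> ? ?; exists B.
Qed.

(** * The graph enlarged by a complete bipartite graph *)

Section Gadget.

Variable G : graph.
Let n := order_of G.

(** Side [A] is numbered first, then [B], then the old vertices; this is the order in which the
    program prints them. *)
Definition place (v : 'I_(n + n + n)) : 'I_n + 'I_n + 'I_n :=
  match split v with inl w => inl (split w) | inr w => inr w end.

Definition gadget_rel : rel 'I_(n + n + n) := fun u v =>
  match place u, place v with
  | inl (inl _), inl (inr _) | inl (inr _), inl (inl _) => true
  | inr x, inr y => adj x y
  | _, _ => false
  end.

Lemma gadget_sym : symmetric gadget_rel.
Proof.
move=> u v; rewrite /gadget_rel.
by case: (place u) (place v) => [[?|?]|?] [[?|?]|?]; rewrite // adj_sym.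
Qed.

Lemma gadget_irrefl : irreflexive gadget_rel.
Proof.
by move=> u; rewrite /gadget_rel; case: (place u) => [[?|?]|?]; rewrite ?adj_irrefl.
Qed.

Definition gadget : graph := Graph gadget_sym gadget_irrefl.

Definition union3 (A B C : {set 'I_n}) : {set vertices gadget} :=
  [set v | match place v with
           | inl (inl x) => x \in A | inl (inr x) => x \in B | inr x => x \in C
           end].

Definition vtxA (x : 'I_n) : vertices gadget := lshift n (lshift n x).
Definition vtxB (x : 'I_n) : vertices gadget := lshift n (rshift n x).
Definition vtxG (x : 'I_n) : vertices gadget := rshift (n + n) x.

Lemma place_A x : place (vtxA x) = inl (inl x).
Proof. by rewrite /place (unsplitK (inl _)) (unsplitK (inl _)). Qed.

Lemma place_B x : place (vtxB x) = inl (inr x).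
Proof. by rewrite /place (unsplitK (inl _)) (unsplitK (inr _)). Qed.

Lemma place_G x : place (vtxG x) = inr x.
Proof. by rewrite /place (unsplitK (inr _)). Qed.

Variant vertex_spec : vertices gadget -> Type :=
| VertexA x : vertex_spec (vtxA x)
| VertexB x : vertex_spec (vtxB x)
| VertexG x : vertex_spec (vtxG x).

Lemma vertexP v : vertex_spec v.
Proof.
by case: (split_ordP v) => w ->; [case: (split_ordP w) => x -> |];
  [apply: VertexA | apply: VertexB | apply: VertexG].
Qed.

Lemma in_union3 A B C :
  ((forall x, (vtxA x \in union3 A B C) = (x \in A)) *
   (forall x, (vtxB x \in union3 A B C) = (x \in B)) *
   (forall x, (vtxG x \in union3 A B C) = (x \in C)))%type.
Proof. by split; [split|] => x; rewrite inE ?place_A ?place_B ?place_G. Qed.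

Lemma union3E (X : {set vertices gadget}) :
  X = union3 [set x | vtxA x \in X] [set x | vtxB x \in X] [set x | vtxG x \in X].
Proof.
by apply/setP=> v; case: (vertexP v) => x; rewrite in_union3 inE.
Qed.

Lemma union3S (A B C A' B' C' : {set 'I_n}) :
  A \subset A' -> B \subset B' -> C \subset C' ->
  union3 A B C \subset union3 A' B' C'.
Proof.
move=> /subsetP sA /subsetP sB /subsetP sC; apply/subsetP=> v.
by case: (vertexP v) => x; rewrite !in_union3; [apply: sA|apply: sB|apply: sC].
Qed.

Lemma card_union3 (A B C : {set 'I_n}) : #|union3 A B C| = #|A| + #|B| + #|C|.
Proof.
rewrite -!sum1_card !big_mkcond big_split_ord /= big_split_ord /=.
by congr (_ + _ + _); rewrite [RHS]big_mkcond; apply: eq_bigr => x _;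
  [rewrite -[lshift n _]/(vtxA x) | rewrite -[lshift n _]/(vtxB x)
  | rewrite -[rshift _ _]/(vtxG x)]; rewrite in_union3.
Qed.

(** A vertex of the first side outside the cover forces the whole second side into it, the two being
    completely joined; no edge links them to the copy of [G]. *)
Lemma union3_cover A B C :
  is_cover (union3 A B C) = ((A == setT) || (B == setT)) && @is_cover G C.
Proof.
apply/idP/andP=> [cX|[AB cC]].
  have edge u v : gadget_rel u v -> (u \in union3 A B C) || (v \in union3 A B C).
    by move: cX => /forallP/(_ u)/forallP/(_ v)/implyP.
  split.
    have [//|nA] /= := eqVneq A setT.
    have [x xA] : exists x, x \notin A.
      apply/existsP; rewrite -negb_forall; apply: contra nA => /forallP allA.
      by apply/eqP/setP=> x; rewrite inE allA.
    apply/eqP/setP=> y; rewrite inE.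
    have := edge (vtxA x) (vtxB y); rewrite /gadget_rel place_A place_B.
    by rewrite !in_union3 (negPf xA); apply.
  apply/forallP=> x; apply/forallP=> y; apply/implyP=> xy.
  by have := edge (vtxG x) (vtxG y); rewrite /gadget_rel !place_G !in_union3; apply.
apply/forallP=> u; apply/forallP=> v; apply/implyP; rewrite /= /gadget_rel !inE.
case: (place u) (place v) => [[x|x]|x] [[y|y]|y] //.
- by case/orP: AB => /eqP ->; rewrite inE ?orbT.
- by case/orP: AB => /eqP ->; rewrite inE ?orbT.
by move: cC => /forallP/(_ x)/forallP/(_ y)/implyP.
Qed.

Lemma enum_gadget : enum (vertices gadget) =
  map vtxA (enum 'I_n) ++ map vtxB (enum 'I_n) ++ map vtxG (enum 'I_n).
Proof.
have enumD a b :
    enum 'I_(a + b) = map (lshift b) (enum 'I_a) ++ map (@rshift a b) (enum 'I_b).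
  have val_enum c : map (@nat_of_ord c) (enum 'I_c) = iota 0 c := val_enum_ord c.
  apply: (inj_map (@ord_inj (a + b))); rewrite val_enum map_cat iotaD.
  congr (_ ++ _); rewrite -map_comp; first by rewrite -val_enum; apply: eq_map.
  by rewrite add0n -[a in iota a]addn0 iotaDl -val_enum -[LHS]map_comp; apply: eq_map.
by rewrite enumD [in LHS]enumD map_cat catA -2!map_comp.
Qed.

End Gadget.

(** * Equivalence of the two instances *)

Section Reduction.

Variable I : vcc_instance.
Let G := vcc_graph I.
Let C := vcc_cover I.
Let n := order_of G.
Let c : nat := #|C|.
(** In this section [k] is the capacity, and [c] the size of the given cover. *)
Let k := 2 * n + c - 1.
Let c_pos : 0 < c := vcc_pos I.
Let S : {set vertices (gadget G)} := union3 setT set0 setT.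
Let T : {set vertices (gadget G)} := union3 set0 setT setT.

Lemma order_pos : 0 < n.
Proof.
by apply: leq_trans (vcc_pos I) _; rewrite -[n]card_ord max_card.
Qed.

Lemma capacity_pos : 0 < k.
Proof. by have := order_pos; rewrite /k; lia. Qed.

Lemma full_cover : @is_cover G setT.
Proof. by apply/forallP=> u; apply/forallP=> v; rewrite !inE implybT. Qed.

Lemma source_cover : is_cover S.
Proof. by rewrite union3_cover eqxx full_cover. Qed.

Lemma target_cover : is_cover T.
Proof. by rewrite union3_cover eqxx orbT full_cover. Qed.

Lemma source_size : #|S| <= k.
Proof.
by have := c_pos; rewrite card_union3 !cardsT !card_ord cards0 -/n /k; lia.
Qed.

Lemma target_size : #|T| <= k.
Proof.
by have := c_pos; rewrite card_union3 !cardsT !card_ord cards0 -/n /k; lia.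
Qed.

Definition reduction : vcr_instance :=
  VCRInstance capacity_pos (expn_gt0 2 (4 * n)) source_cover target_cover
    source_size target_size.

Lemma reduction_complete : vcc_yes I -> vcr_yes reduction.
Proof.
case=> C1 [cC1 sC1]; have := c_pos; rewrite -[#|vcc_cover I|]/c in sC1 => c_gt0.
(* Each of the four phases is allowed as many steps as the gadget has vertices; [12 * n <= 16 ^ n]
   holds because [n] is positive. *)
have le_time : 4 * (n + n + n) <= 2 ^ (4 * n).
  rewrite expnM -[2 ^ 4]/16; elim: (n) order_pos => // -[|m] IH _ //.
  by have := IH isT; rewrite (expnS 16 m.+1); lia.
have le_diff (X Y : {set vertices (gadget G)}) : #|X :\: Y| <= n + n + n.
  by rewrite -[X in _ <= X]card_ord max_card.
apply: reconfigurable_leq le_time _; rewrite /= !mulSn addn0.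
pose X1 : {set vertices (gadget G)} := union3 setT set0 C1.
pose X2 : {set vertices (gadget G)} := union3 setT setT C1.
pose X3 : {set vertices (gadget G)} := union3 set0 setT C1.
have cX1 : is_cover X1 by rewrite union3_cover eqxx.
have cX3 : is_cover X3 by rewrite union3_cover eqxx orbT.
(* The peak of the sequence: both sides together with [C1] fill the capacity exactly. *)
have sX2 : #|X2| <= k by rewrite card_union3 !cardsT !card_ord sC1 -/n /k; lia.
apply: (@reconfigurable_trans _ _ _ _ _ X1).
  apply: reconfigurable_leq (le_diff S X1) _.
  by apply: reconfigurable_shrink source_size => //; apply: union3S.
apply: (@reconfigurable_trans _ _ _ _ _ X2).
  apply: reconfigurable_leq (le_diff X2 X1) _.
  by apply: reconfigurable_grow => //; apply: union3S; rewrite ?sub0set.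
apply: (@reconfigurable_trans _ _ _ _ _ X3).
  apply: reconfigurable_leq (le_diff X2 X3) _.
  by apply: reconfigurable_shrink => //; apply: union3S; rewrite ?sub0set.
apply: reconfigurable_leq (le_diff T X3) _.
by apply: reconfigurable_grow target_size => //; apply: union3S.
Qed.

Lemma reduction_sound : vcr_yes reduction -> vcc_yes I.
Proof.
case=> s [_ ps es].
pose P (X : {set vertices (gadget G)}) := [set x | vtxB x \in X] == setT.
have nPS : ~~ P S.
  apply/negP => /eqP/setP/(_ (Ordinal order_pos)).
  by rewrite !inE place_B inE.
have PT : P (last S s).
  by rewrite es; apply/eqP/setP=> x; rewrite !inE place_B inE.
(* The moment at which [B] is completed. A removal cannot complete it, so this step adds a vertex;
   and [X], a cover missing part of [B], contains all of [A]. *)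
have [X [Y [cX /and3P[st cY sY] nPX PY]]] := path_crossing source_cover ps nPS PT.
have sXY : X \subset Y.
  case/existsP: st => v /orP[] /andP[_ /eqP eY]; first by rewrite eY subsetUr.
  case/negP: nPX; apply/eqP/setP=> x; rewrite !inE.
  by move/eqP/setP/(_ x): PY; rewrite eY !inE => /andP[].
have AX : [set x | vtxA x \in X] = setT.
  move: cX; rewrite {1}[X]union3E union3_cover => /andP[+ _].
  by rewrite -/(P X) (negPf nPX) orbF => /eqP.
have AY : [set x | vtxA x \in Y] = setT.
  apply/setP=> x; move/setP/(_ x): AX; rewrite !inE.
  exact: (subsetP sXY).
move: cY sY; rewrite [Y]union3E union3_cover card_union3 AY (eqP PY) !cardsT !card_ord.
set D := [set x | _] => /andP[_ cD] sD.
(* The two sides take up [2 * n] of the capacity, so [D] has at most [c - 1] vertices and is padded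
   to exactly that size. *)
have [|E sDE sE] := @card_superset _ D (c - 1); last first.
  by exists E; split; [apply: is_coverS cD | ].
have le_cn : c <= #|'I_n| by apply: max_card.
have := c_pos; move: sD le_cn; rewrite [vcr_k _]/= card_ord -/n /k. move: #|D| => d; lia.
Qed.

End Reduction.

(** * Encodings *)

Definition rows_of (G : graph) : seq (seq bool) :=
  [seq [seq adj u v | v <- enum 'I_(order_of G)] | u <- enum 'I_(order_of G)].

Lemma enc_setE n (A : pred 'I_n) : enc_set A = row_word [seq A v | v <- enum 'I_n].
Proof. by rewrite /row_word -map_comp. Qed.

Lemma enc_graphE (G : graph) :
  enc_graph G = flatten (map row_word (rows_of G)) ++ [:: #s].
Proof.
rewrite /enc_graph -cats1 /rows_of -map_comp; congr (flatten _ ++ _).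
by apply: eq_map => u; rewrite enc_setE.
Qed.

Lemma size_enc_set n (A : pred 'I_n) : size (enc_set A) = n.+1.
Proof. by rewrite /enc_set size_rcons size_map size_enum_ord. Qed.

Lemma map_enum_const (U : Type) n (h : 'I_n -> U) a :
  (forall x, h x = a) -> map h (enum 'I_n) = nseq n a.
Proof.
move=> ha; rewrite -[in RHS](size_enum_ord n).
by elim: (enum 'I_n) => //= x s ->; rewrite ha.
Qed.

Lemma size_enc_graph (G : graph) :
  size (enc_graph G) = order_of G * (order_of G).+1 + 1.
Proof.
rewrite /enc_graph size_rcons size_flatten addn1; congr _.+1.
rewrite /shape -map_comp (map_enum_const (a := (order_of G).+1)).
  by rewrite sumn_nseq mulnC.
by move=> u /=; rewrite size_enc_set.
Qed.

Lemma map_enum_gadget (G : graph) (U : Type) (h : vertices (gadget G) -> U) :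
  map h (enum (vertices (gadget G))) =
  [seq h (vtxA x) | x <- enum 'I_(order_of G)] ++
  [seq h (vtxB x) | x <- enum 'I_(order_of G)] ++
  [seq h (vtxG x) | x <- enum 'I_(order_of G)].
Proof.
by rewrite enum_gadget !map_cat; congr (_ ++ (_ ++ _)); rewrite -map_comp.
Qed.

(** Applies to the matrix rows of [A] and [B] and to the source and target sets, all constant on
    each part of the gadget. *)
Lemma gadget_lineE (G : graph) (p : pred (vertices (gadget G))) a b c :
    (forall x, p (vtxA x) = a) -> (forall x, p (vtxB x) = b) ->
    (forall x, p (vtxG x) = c) ->
  enc_set p = line (order_of G) (Some a) (Some b) (Some c).
Proof.
move=> pA pB pC; rewrite /enc_set -cats1 map_enum_gadget -!catA /line.
by congr (_ ++ (_ ++ (_ ++ _))); apply: map_enum_const => x; rewrite ?pA ?pB ?pC.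
Qed.

Lemma enc_gadget (G : graph) (n := order_of G) :
  enc_graph (gadget G) =
  flatten (nseq n (line n 0s 1s 0s)) ++ flatten (nseq n (line n 1s 0s 0s)) ++
     flatten [seq nseq n 0s ++ nseq n 0s ++ row_word r | r <- rows_of G] ++ [:: #s].
Proof.
rewrite /enc_graph map_enum_gadget -cats1 !flatten_cat -!catA.
congr (flatten _ ++ (flatten _ ++ (flatten _ ++ _))).
- apply: map_enum_const => x.
  by apply: gadget_lineE => y; rewrite /= /gadget_rel ?place_A ?place_B ?place_G.
- apply: map_enum_const => x.
  by apply: gadget_lineE => y; rewrite /= /gadget_rel ?place_A ?place_B ?place_G.
rewrite /rows_of -map_comp; apply: eq_map => x /=.
rewrite /enc_set map_enum_gadget /row_word -!cats1 -!catA.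
congr (_ ++ (_ ++ (_ ++ _))).
- by apply: map_enum_const => y; rewrite /= /gadget_rel place_G place_A.
- by apply: map_enum_const => y; rewrite /= /gadget_rel place_G place_B.
by rewrite -map_comp; apply: eq_map => y; rewrite /= /gadget_rel !place_G.
Qed.

Section Encoding.

Variable I : vcc_instance.
Let n := order_of (vcc_graph I).
Let R := rows_of (vcc_graph I).
Let c := [seq v \in vcc_cover I | v <- enum 'I_n].

Lemma count_cover : count id c = #|vcc_cover I|.
Proof. by rewrite count_map -sum1_card -sum1_count big_enum_cond. Qed.

Lemma encode_input : vcc_encode I = flatten (map row_word R) ++ #s :: row_word c.
Proof. by rewrite /vcc_encode enc_graphE enc_setE -catA. Qed.

Lemma encode_output : vcr_encode (reduction I) = output_word n R c.
Proof.
rewrite /vcr_encode /output_word enc_gadget count_cover; congr (_ ++ _).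
rewrite -[RHS]catA; congr (_ ++ (_ ++ _)).
  by apply: (@gadget_lineE (vcc_graph I) _ true false true) => x; rewrite in_union3 inE.
by apply: (@gadget_lineE (vcc_graph I) _ false true true) => x; rewrite in_union3 inE.
Qed.

(** The adjacency matrix makes the input quadratic in [n], so a time quadratic in [n] is linear in
    the input size. *)
Lemma size_input : n.+1 ^ 2 <= size (vcc_encode I).
Proof. by rewrite size_cat size_enc_graph size_enc_set -/n; lia. Qed.

Lemma size_output : size (output_word n R c) <= 40 * n.+1 ^ 2.
Proof.
rewrite -encode_output !size_cat size_enc_graph !size_enc_set enc_pow2 size_cat size_nseq.
rewrite /enc_nat size_rcons size_mkseq /=.
have : #|vcc_cover I| <= n by rewrite -[n in _ <= n]card_ord max_card.
move: #|_| => m; rewrite -/n.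
(* Bounding the number of digits by the capacity itself is crude but still linear in [n]. *)
have : trunc_log 2 (2 * n + m - 1) <= 2 * n + m - 1.
  have [->|m_gt0] := posnP (2 * n + m - 1); first by rewrite trunc_log0.
  by apply: leq_trans (trunc_logP (isT : 1 < 2) m_gt0); apply/ltnW/ltn_expl.
lia.
Qed.

End Encoding.

(** * The polynomial-time reduction *)

Lemma reducer_init (w : seq symbol) :
  tm_init (machine_of reducer) w =
  (Some (rt_start reducer), store false (blank_tape symbol) (blank_tape symbol)
     (situation [::] w [::] None [::])).
Proof.
congr (_, _); apply: eq_from_tnth => i; rewrite tnth_mktuple.
rewrite (tnth_nth (blank_tape symbol)) map_id.
by case: i => [[|[|[|[|[|[|]]]]]]].
Qed.

Theorem theorem4 :
  polytime_many_one_reducible VertexCoverCompression VertexCoverReconfiguration.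
Proof.
exists reduction; split; last first.
  by move=> I; split; [apply: reduction_complete | apply: reduction_sound].
(* A linear polynomial suffices: the main program takes [cost main_code * n.+1 ^ 2] steps, and 100
   covers twice the output length, at most [80 * n.+1 ^ 2], as well as [6 * n + 10]. *)
exists (machine_of reducer), ('X *+ (cost main_code + 100))%R => I.
rewrite hornerMn hornerX -GRing.mulr_natr !natrE.
rewrite -[encode I]/(vcc_encode I) -[encode _]/(vcr_encode (reduction I)).
have := size_input I; have := size_output I; rewrite encode_output encode_input.
set n := order_of (vcc_graph I); set R := rows_of (vcc_graph I).
set c := [seq v \in vcc_cover I | v <- enum 'I_n] => le_out le_in.
have size_row r : r \in R -> size r = n.
  by case/mapP=> u _ ->; rewrite size_map size_enum_ord.
have size_R : size R = n by rewrite size_map size_enum_ord.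
have n_gt0 : 0 < n := order_pos I.
have has_c : has id c by rewrite has_count count_cover; apply: vcc_pos.
have size_c : size c = n by rewrite size_map size_enum_ord.
(* As [n] is positive, there is a first row from which the machine reads off [n]. *)
have [r [R' ER]] : exists r R', R = r :: R'.
  by case: (R) size_R => [|r R'] eR; [rewrite -eR in n_gt0 | exists r, R'].
rewrite {}ER in size_row size_R le_in le_out *.
have [|||t [u [x [run Hx]]]] := @runs_reducer n r R' c n_gt0 _ _ _ size_c has_c.
- by apply: size_row; apply: mem_head.
- by rewrite -size_R.
- by apply/allP=> r' r'R; rewrite size_row // inE r'R orbT.
rewrite /computes_within reducer_init (machine_runs run) ?map_id //.
move: (cost main_code) le_out le_in => K.
move: (size _) (size _) => so si; nia.
Qed.
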